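(* The antipode of the Hopf monoid of matroids is given by the following cancellation-free and grouping-free formula. If $m$ is a matroid on $I$, then $$\mathsf s_I(m)=\sum_{n\le m}(-1)^{c(n)}\,n,$$ where the sum is over all the nonempty faces $n$ of the matroid polytope of $m$ (each identified with the matroid whose matroid polytope it is), and $c(n)$ is the number of connected components of the matroid $n$.
   Context: $\mathrm M[I]$ is the set of matroids with finite ground set $I$, given by their collections of bases; $\mathbf M[I]$ is the vector space with basis $\mathrm M[I]$ over a field of characteristic $0$. For an ordered decomposition $I=S\sqcup T$, the product of $m_1\in\mathrm M[S]$ and $m_2\in\mathrm M[T]$ is the direct sum $m_1\oplus m_2$, and the coproduct is $\Delta_{S,T}(m)=m|_S\otimes m/_S$, where $m|_S$ is the restriction of $m$ to $S$ and $m/_S$ is the contraction of $S$ in $m$ (a matroid on $T$). These make $\mathbf M$ a connected Hopf monoid. With $\mu_{S_1,\dots,S_k},\Delta_{S_1,\dots,S_k}$ the iterated (co)products, the antipode is $\mathsf s_\emptyset=\mathrm{id}$ and, for $I\neq\emptyset$, $\mathsf s_I=\sum(-1)^k\mu_{S_1,\dots,S_k}\circ\Delta_{S_1,\dots,S_k}$, over all $k\ge1$ and ordered sequences of nonempty pairwise disjoint $S_1,\dots,S_k$ with union $I$. The matroid polytope of a matroid $m$ on $I$ is $\mathcal P(m)=\mathrm{conv}\{e_{b_1}+\cdots+e_{b_r}:\{b_1,\dots,b_r\}\text{ a basis of }m\}\subset\mathbb RI$. Every nonempty face of $\mathcal P(m)$ is the matroid polytope $\mathcal P(n)$ of a unique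 matroid $n$ on $I$; $n\le m$ means that $\mathcal P(n)$ is a nonempty face of $\mathcal P(m)$. Every matroid has a unique maximal decomposition as a direct sum of smaller matroids; the summands are its connected components. An expression $\sum_\alpha c_\alpha x_\alpha$ in basis elements is cancellation-free if no $\alpha\ne\beta$ have $x_\alpha=x_\beta$ with $c_\alpha,c_\beta$ of opposite sign, and grouping-free if the $x_\alpha$ are pairwise distinct. *)

(* Defs.v *)
From HB Require Import structures.
From mathcomp Require Import boolp classical_sets reals.
From mathcomp Require Import all_boot all_order all_algebra.

Set Implicit Arguments.
Unset Strict Implicit.
Unset Printing Implicit Defensive.

Import Order.TTheory GRing.Theory Num.Theory.

(* The finite sets carrying matroids are the subsets of an arbitrary finite
   type T; taking [set: T] for the ground set gives every finite type. *)

Section Matroids.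
Variable T : finType.
Implicit Types (A I S b c : {set T}) (B : {set {set T}}).

Definition bases_axiom I B : bool :=
  [&& B != set0, [forall b in B, b \subset I] &
      [forall b1 in B, forall b2 in B, forall e in b1 :\: b2,
         exists f in b2 :\: b1, f |: (b1 :\ e) \in B]].

Record matroid I := Matroid {
  bases : {set {set T}};
  basesP : bases_axiom I bases }.

HB.instance Definition _ I := [isSub for @bases I].
HB.instance Definition _ I := [Finite of matroid I by <:].

Definition indep B A := [exists b in B, A \subset b].

Definition restrict_bases B S : {set {set T}} :=
  [set A | maxset [pred C | indep B C && (C \subset S)] A].

(* All bases c of the restriction to S give the same family of sets A; see
   restrict_bases_swap. *)
Definition contract_bases B S : {set {set T}} :=
  [set A : {set T} | [disjoint A & S] &&
           [exists c in restrict_bases B S, A :|: c \in B]].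

Definition sum_bases B1 B2 : {set {set T}} :=
  [set b1 :|: b2 | b1 in B1, b2 in B2].

Lemma bases_axiomP I B :
  reflect [/\ exists b, b \in B, forall b, b \in B -> b \subset I &
     forall b1 b2 e, b1 \in B -> b2 \in B -> e \in b1 -> e \notin b2 ->
     exists f, [/\ f \in b2, f \notin b1 & f |: (b1 :\ e) \in B]]
  (bases_axiom I B).
Proof.
apply: (iffP and3P) => -[].
- move=> /set0Pn Bn0 /forall_inP BI /forall_inP ex; split=> //.
  move=> b1 b2 e b1B b2B eb1 eb2.
  move: (ex _ b1B) => /forall_inP/(_ _ b2B)/forall_inP/(_ e).
  rewrite inE eb1 eb2 => /(_ isT)/exists_inP[f].
  by rewrite inE => /andP[fb1 fb2] fB; exists f.
- move=> Bn0 BI ex; split; first exact/set0Pn.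
  + exact/forall_inP.
  apply/forall_inP=> b1 b1B; apply/forall_inP=> b2 b2B; apply/forall_inP=> e.
  rewrite inE => /andP[eb2 eb1].
  have [f [fb2 fb1 fB]] := ex _ _ _ b1B b2B eb1 eb2.
  by apply/exists_inP; exists f => //; rewrite inE fb1.
Qed.

Lemma card_bases I B b1 b2 : bases_axiom I B -> b1 \in B -> b2 \in B ->
  #|b1| = #|b2|.
Proof.
move=> /bases_axiomP[_ _ ex].
have [n] := ubnP #|b1 :\: b2|; elim: n b1 => // n IHn b1 ltn b1B b2B.
have [/eqP|[e]] := set_0Vmem (b1 :\: b2).
  rewrite setD_eq0 => sb12; congr #|pred_of_set _|; apply/eqP.
  rewrite eqEsubset sb12; apply/subsetP => e eb2; apply: contraT => eb1.
  have [f [fb1 + _]] := ex _ _ _ b2B b1B eb2 eb1.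
  by rewrite (subsetP sb12).
rewrite inE => /andP[eb2 eb1].
have [f [fb2 fb1 fB]] := ex _ _ _ b1B b2B eb1 eb2.
rewrite -(IHn (f |: b1 :\ e)) //.
  by rewrite cardsU1 !inE (negbTE fb1) andbF add1n (cardsD1 e b1) eb1.
apply: leq_trans (_ : #|b1 :\: b2| <= n); last by rewrite -ltnS.
apply: proper_card; apply/properP; split.
  apply/subsetP=> z; rewrite !inE.
  by case: (z =P f) => [->|_]; [rewrite fb2 | case: (z \in b2) => // /= /andP[]].
exists e; rewrite !inE ?eb1 ?eb2 // eqxx /= orbF.
by apply/negbT/eqP => ef; rewrite -ef eb1 in fb1.
Qed.

Lemma extend_basis I B A b0 : bases_axiom I B -> indep B A -> b0 \in B ->
  exists b, [/\ b \in B, A \subset b & b \subset A :|: b0].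
Proof.
move=> /bases_axiomP[_ _ ex] /exists_inP[b1 b1B Ab1] b0B.
pose Q := [pred b : {set T} | (b \in B) && (A \subset b)].
have Qb1 : Q b1 by rewrite /= b1B.
case: (arg_maxnP (fun b : {set T} => #|b :&: b0|) Qb1) => b /andP[bB Ab] bmax.
exists b; split=> //; apply/subsetP=> e eb; rewrite inE.
have [//|eA /=] := boolP (e \in A); apply: contraT => eb0.
have [f [fb0 fb fB]] := ex _ _ _ bB b0B eb eb0.
have /bmax : Q (f |: b :\ e).
  rewrite /= fB; apply/subsetP=> z zA; rewrite !inE (subsetP Ab) // andbT.
  by case: (z =P e) => [ze|]; [rewrite -ze zA in eA | rewrite orbT].
rewrite /= leqNgt => /negP[]; apply: proper_card; apply/properP; split.
  apply/subsetP=> z; rewrite !inE => /andP[zb zb0]; rewrite zb zb0 !andbT.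
  by case: (z =P e) => [ze|]; [rewrite -ze zb0 in eb0 | rewrite orbT].
by exists f; rewrite !inE ?eqxx ?fb0 // (negbTE fb).
Qed.

Lemma restrict_basesP B S A : A \in restrict_bases B S ->
  [/\ indep B A, A \subset S &
      forall C, indep B C -> C \subset S -> A \subset C -> C = A].
Proof.
rewrite inE => /maxsetP[/andP[iA AS] Amax]; split=> // C iC CS AC.
by apply: Amax => //=; rewrite iC.
Qed.

Lemma restrict_capP B S c b : c \in restrict_bases B S -> b \in B ->
  c \subset b -> b :&: S = c.
Proof.
move=> /restrict_basesP[ic cS cmax] bB cb.
apply: cmax; last by rewrite subsetI cb cS.
  by apply/exists_inP; exists b; rewrite ?subsetIl.
exact: subsetIr.
Qed.

Lemma cardsU_disjoint A c : [disjoint A & c] -> #|A :|: c| = #|A| + #|c|.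
Proof. by move=> /disjoint_setI0 d; rewrite cardsU d cards0 subn0. Qed.

Lemma disjointsD b S : [disjoint b :\: S & S].
Proof. by rewrite disjoints_subset setDE subsetIr. Qed.

Lemma restrict_bases_swap I B S c c' A : bases_axiom I B ->
  c \in restrict_bases B S -> c' \in restrict_bases B S -> [disjoint A & S] ->
  A :|: c' \in B -> A :|: c \in B.
Proof.
move=> Bax cR c'R dAS AcB.
have [ic cS _] := restrict_basesP cR; have [ic' c'S _] := restrict_basesP c'R.
have [b [bB cb bs]] := extend_basis Bax ic AcB.
have bS := restrict_capP cR bB cb.
have bAc' c'' : c'' \subset S -> #|A :|: c''| = #|A| + #|c''|.
  by move=> sS; apply: cardsU_disjoint; apply: disjointWr dAS.
have bA : b \subset A :|: c.
  apply/subsetP=> z zb; move/subsetP/(_ z zb): bs; rewrite !inE.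
  case/or3P => [-> //|->//|zc']; first by rewrite orbT.
  by rewrite -bS inE zb (subsetP c'S) ?orbT.
have [b' [b'B c'b' b's]] := extend_basis Bax ic' bB.
have b'S := restrict_capP c'R b'B c'b'.
have leb : #|A :|: c| <= #|b|.
  rewrite bAc' // (card_bases Bax bB AcB) bAc' // leq_add2l.
  have : #|b'| <= #|b :\: S| + #|c'|.
    apply: leq_trans (leq_card_setU _ _).1; apply: subset_leq_card.
    apply/subsetP=> z zb'; rewrite !inE.
    have [zS|zS] := boolP (z \in S); first by rewrite -b'S inE zb' zS orbT.
    by move/subsetP/(_ z zb'): b's; rewrite inE orbC.
  rewrite (card_bases Bax b'B bB) -(cardsID S b) bS addnC leq_add2l //.
by have /eqP <- : b == A :|: c by rewrite eqEcard bA leb.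
Qed.

Lemma card_restrict_bases I B S c c' : bases_axiom I B ->
  c \in restrict_bases B S -> c' \in restrict_bases B S -> #|c| = #|c'|.
Proof.
move=> Bax cR c'R; have [/exists_inP[b bB cb] cS _] := restrict_basesP cR.
have [_ c'S _] := restrict_basesP c'R.
have bS := restrict_capP cR bB cb.
have d := disjointsD b S.
have cB : (b :\: S) :|: c \in B by rewrite -bS setUC setID.
have c'B := restrict_bases_swap Bax c'R cR d cB.
have := card_bases Bax cB c'B.
by rewrite !cardsU_disjoint; [move/addnI | apply: disjointWr d ..].
Qed.

Lemma restrict_basesI I B S A : bases_axiom I B -> indep B A -> A \subset S ->
  (exists2 c, c \in restrict_bases B S & #|c| <= #|A|) ->
  A \in restrict_bases B S.
Proof.
move=> Bax iA AS [c cR lec].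
have /maxset_exists[A' A'max AA'] :
  [pred C | indep B C && (C \subset S)] A by rewrite /= iA.
have A'R : A' \in restrict_bases B S by rewrite inE.
suff -> : A = A' by [].
by apply/eqP; rewrite eqEcard AA' (card_restrict_bases Bax A'R cR).
Qed.

Lemma restrict_axiom I (m : matroid I) S :
  bases_axiom S (restrict_bases (bases m) S).
Proof.
have Bax := basesP m; move: (bases m) Bax => B Bax.
have [[b0 b0B] _ _] := bases_axiomP _ _ Bax.
apply/bases_axiomP; split.
- have /maxset_exists[c cmax _] : [pred C | indep B C && (C \subset S)] set0.
    by rewrite /= sub0set andbT; apply/exists_inP; exists b0; rewrite ?sub0set.
  by exists c; rewrite inE.
- by move=> c /restrict_basesP[].
move=> c1 c2 e c1R c2R ec1 ec2.
have [/exists_inP[b1 b1B c1b1] c1S _] := restrict_basesP c1R.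
have [/exists_inP[b2 b2B c2b2] c2S _] := restrict_basesP c2R.
have b1S := restrict_capP c1R b1B c1b1.
have d := disjointsD b1 S.
have c1B : (b1 :\: S) :|: c1 \in B by rewrite -b1S setUC setID.
have c2B := restrict_bases_swap Bax c2R c1R d c1B.
have [_ _ ex] := bases_axiomP _ _ Bax.
have eS : e \in S := subsetP c1S _ ec1.
have [||f [+ + fB]] := ex _ _ e c1B c2B; first by rewrite inE ec1 orbT.
  by rewrite !inE eS (negbTE ec2).
rewrite !inE => + /norP[nf fc1]; rewrite (negbTE nf) /= => fc2.
exists f; split=> //; apply: (restrict_basesI Bax).
- apply/exists_inP; exists (f |: (b1 :\: S :|: c1) :\ e) => //.
  by rewrite setUS // setSD // subsetUr.
- rewrite subUset sub1set (subsetP c2S) //=.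
  exact: subset_trans (subD1set _ _) c1S.
exists c1 => //.
by rewrite cardsU1 !inE (negbTE fc1) andbF add1n (cardsD1 e c1) ec1.
Qed.

Lemma contract_axiom I (m : matroid I) S :
  bases_axiom (I :\: S) (contract_bases (bases m) S).
Proof.
have [[c0 c0R] _ _] := bases_axiomP _ _ (restrict_axiom m S).
have Bax := basesP m; move: (bases m) Bax c0R => B Bax c0R.
have [_ BI ex] := bases_axiomP _ _ Bax.
apply/bases_axiomP; split.
- have [/exists_inP[b bB c0b] c0S _] := restrict_basesP c0R.
  exists (b :\: S); rewrite inE disjointsD /=.
  apply/exists_inP; exists c0 => //.
  by rewrite -(restrict_capP c0R bB c0b) setUC setID.
- move=> A; rewrite inE => /andP[d /exists_inP[c _ /BI]].
  by rewrite subUset subsetD d andbT => /andP[].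
move=> A1 A2 e; rewrite !inE => /andP[d1 /exists_inP[c1 c1R A1B]].
move=> /andP[d2 /exists_inP[c2 c2R A2B]] e1 e2.
have A2B' := restrict_bases_swap Bax c1R c2R d2 A2B.
have [_ c1S _] := restrict_basesP c1R.
have eS : e \notin S by rewrite (disjointFr d1).
have ec1 : e \notin c1 by apply: contra eS; apply: (subsetP c1S).
have [||f [+ + fB]] := ex _ _ e A1B A2B'; first by rewrite inE e1.
  by rewrite inE (negbTE e2).
rewrite !inE => + /norP[f1 fc1]; rewrite (negbTE fc1) orbF => f2.
exists f; split=> //; rewrite inE; apply/andP; split.
  rewrite disjoints_subset subUset sub1set inE (disjointFr d2) //=.
  rewrite -disjoints_subset; by apply: disjointWl d1; apply: subD1set.
apply/exists_inP; exists c1 => //; rewrite -setUA.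
suff <- : (A1 :|: c1) :\ e = A1 :\ e :|: c1 by [].
by apply/setP=> z; rewrite !inE; case: (z =P e) => [->|]; rewrite ?(negbTE ec1).
Qed.

Lemma sum_axiom I S (m1 : matroid S) (m2 : matroid (I :\: S)) :
  S \subset I -> bases_axiom I (sum_bases (bases m1) (bases m2)).
Proof.
move=> SI; have [[b1 b1B] B1S ex1] := bases_axiomP _ _ (basesP m1).
have [[b2 b2B] B2S ex2] := bases_axiomP _ _ (basesP m2).
apply/bases_axiomP; split.
- by exists (b1 :|: b2); apply/imset2P; exists b1 b2.
- move=> _ /imset2P[c1 c2 /B1S s1 /B2S + ->]; rewrite subsetD => /andP[s2 _].
  by rewrite subUset s2 (subset_trans s1).
move=> _ _ e /imset2P[c1 c2 c1B c2B ->] /imset2P[d1 d2 d1B d2B ->].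
have no z x1 x2 : x1 \in bases m1 -> x2 \in bases m2 ->
    z \in x1 -> z \notin x2.
  by move=> /B1S/subsetP s1 /B2S/subsetP s2 /s1 zS; apply/negP => /s2; rewrite inE zS.
rewrite !inE => /orP[] ec /norP[ed1 ed2].
- have [f [fd fc fB]] := ex1 _ _ _ c1B d1B ec ed1.
  exists f; rewrite !inE fd (negbTE fc) /=; split=> //.
    exact: no fd.
  apply/imset2P; exists (f |: c1 :\ e) c2 => //; rewrite -setUA; congr (_ :|: _).
  apply/setP=> z; rewrite !inE; case: (z =P e) => // -> /=.
  by apply/esym/negbTE; apply: no ec.
- have [f [fd fc fB]] := ex2 _ _ _ c2B d2B ec ed2.
  exists f; rewrite !inE fd (negbTE fc) /= orbT orbF; split=> //.
    by apply: contraL fd; apply: no.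
  apply/imset2P; exists c1 (f |: c2 :\ e) => //; rewrite setUCA; congr (_ :|: _).
  apply/setP=> z; rewrite !inE; case: (z =P e) => [->|//] /=; rewrite orbF.
  by apply/esym/negbTE; apply: contraL ec; apply: no.
Qed.

Lemma empty_axiom I : bases_axiom I [set set0].
Proof.
apply/bases_axiomP; split; first by exists set0; rewrite inE.
  by move=> b /set1P->; apply: sub0set.
by move=> b1 b2 e /set1P-> _; rewrite inE.
Qed.

(* S need not be included in I; the elements of S :\: I are then loops. *)
Definition restrict I (m : matroid I) S : matroid S :=
  Matroid (restrict_axiom m S).

Definition contract I (m : matroid I) S : matroid (I :\: S) :=
  Matroid (contract_axiom m S).

(* An ordered decomposition of I in two blocks is given by its first block. *)
Definition direct_sum I S (SI : S \subset I)
    (m1 : matroid S) (m2 : matroid (I :\: S)) : matroid I :=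
  Matroid (sum_axiom m1 m2 SI).

(* The matroid of rank 0, which for I = set0 is the only matroid on I. *)
Definition empty_matroid I : matroid I := Matroid (empty_axiom I).

Definition ordered_decomposition I (s : seq {set T}) : bool :=
  [&& all (fun S => S != set0) s,
      pairwise (fun S S' => [disjoint S & S']) s &
      \bigcup_(S <- s) S == I].

Lemma ordered_decomposition_cons I S s : ordered_decomposition I (S :: s) ->
  (S \subset I) /\ ordered_decomposition (I :\: S) s.
Proof.
move=> /and3P[/= /andP[_ s0] /andP[dS ds] /eqP <-].
rewrite /ordered_decomposition s0 ds big_cons subsetUl; split=> //=.
rewrite setDUl setDv set0U eq_sym setDE; apply/eqP/setIidPl.
elim: {s0 ds} s dS => [|S' s IHs] /=; first by rewrite big_nil sub0set.
rewrite big_cons subUset => /andP[dS' /IHs ->].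
by rewrite -disjoints_subset disjoint_sym dS'.
Qed.

(* The basis of M[S_1] (x) ... (x) M[S_k] formed by the tensors of matroids. *)
Fixpoint tensor_basis (s : seq {set T}) : finType :=
  if s is A :: s' then (matroid A * tensor_basis s')%type else unit.

(* The iterated coproduct peels blocks off from the left. It is carried down to
   the empty sequence, where only the matroid on set0 is left; on the last
   block S_k of an ordered decomposition it restricts to the whole ground set
   S_k, hence is the identity. Likewise for the product. *)
Fixpoint coproduct_basis (s : seq {set T}) I (m : matroid I) :
    tensor_basis s :=
  if s is A :: s' then (restrict m A, coproduct_basis s' (contract m A)) else tt.

Fixpoint product_basis (s : seq {set T}) :
    forall I, ordered_decomposition I s -> tensor_basis s -> matroid I :=
  match s with
  | [::] => fun I _ _ => empty_matroid I
  | _ :: s' => fun I sI t =>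
      let: conj SI s'I := ordered_decomposition_cons sI in
      direct_sum SI t.1 (product_basis s'I t.2)
  end.

(* m is the direct sum of matroids n S on the blocks S of P. *)
Definition is_direct_sum I (m : matroid I) (P : {set {set T}}) : Prop :=
  partition P I /\ exists n : forall S, matroid S,
    bases m = \big[sum_bases/[set set0]]_(S in P) bases (n S).

Definition refines (Q P : {set {set T}}) : bool :=
  [forall S in Q, exists S' in P, S \subset S'].

Definition is_maximal_direct_sum I (m : matroid I) (P : {set {set T}}) : Prop :=
  is_direct_sum m P /\
  forall Q, is_direct_sum m Q -> refines Q P -> Q = P.

(* The maximal decomposition exists and is unique, so that xget selects it and
   never returns its default value. *)
Definition components I (m : matroid I) : {set {set T}} :=
  xget set0 (is_maximal_direct_sum m).

Definition num_components I (m : matroid I) : nat := #|components m|.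

End Matroids.

Local Open Scope ring_scope.

Section Linearization.
Variable K : fieldType.

Definition freeVect (X : finType) := {ffun X -> K^o}.

Definition vect (X : finType) (x : X) : freeVect X := [ffun y => (y == x)%:R].

Definition linext (X Y : finType) (f : X -> Y) (v : freeVect X) : freeVect Y :=
  \sum_(x : X) v x *: vect (f x).

Variable T : finType.

Definition product (I : {set T}) (s : seq {set T})
    (sI : ordered_decomposition I s) :
    freeVect (tensor_basis s) -> freeVect (matroid I) :=
  linext (product_basis sI).

Definition coproduct (I : {set T}) (s : seq {set T}) :
    freeVect (matroid I) -> freeVect (tensor_basis s) :=
  linext (coproduct_basis s (I := I)).

(* k is bounded by #|I| because the k blocks are nonempty and disjoint. *)
Definition antipode (I : {set T}) (v : freeVect (matroid I)) :
    freeVect (matroid I) :=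
  if I == set0 then v else
  \sum_(1 <= k < #|I|.+1)
    \sum_(s : {s : k.-tuple {set T} | ordered_decomposition I s})
      (-1) ^+ k *: product (valP s) (coproduct (val s) v).

End Linearization.

Section Polytopes.
Variable R : realType.

Definition convex_hull (V : lmodType R) (X : set V) : set V :=
  [set x | exists (n : nat) (w : 'I_n -> R) (p : 'I_n -> V),
     [/\ forall i, 0 <= w i, \sum_i w i = 1, forall i, X (p i) &
         x = \sum_i w i *: p i]]%classic.

Variable T : finType.
Implicit Types (x y z : {ffun T -> R^o}) (P F : set {ffun T -> R^o}).

Definition indicator (b : {set T}) : {ffun T -> R^o} :=
  [ffun i => (i \in b)%:R].

(* RI is seen inside RT as the subspace of vectors supported on I. *)
Definition matroid_polytope (I : {set T}) (m : matroid I) :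
    set {ffun T -> R^o} :=
  convex_hull [set indicator b | b in [set` bases m]]%classic.

Definition pairing y x : R := \sum_i y i * x i.

Definition is_face F P : Prop :=
  F = classical_sets.set0 \/
  exists y, F = [set x | P x /\ forall z, P z -> pairing y z <= pairing y x]%classic.

Definition matroid_face (I : {set T}) (n m : matroid I) : Prop :=
  is_face (matroid_polytope n) (matroid_polytope m) /\
  (matroid_polytope n !=set0)%classic.

End Polytopes.

(* Formal expressions sum_(a | D a) c a * x a with integer coefficients. *)

Definition cancellation_free (A : Type) (V : Type)
    (D : A -> Prop) (c : A -> int) (x : A -> V) : Prop :=
  forall a b, D a -> D b -> a <> b -> x a = x b -> ~ (c a * c b < 0).

Definition grouping_free (A : Type) (V : Type)
    (D : A -> Prop) (x : A -> V) : Prop :=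
  forall a b, D a -> D b -> a <> b -> x a <> x b.

(* Main.v *)
Require Import Defs.
From mathcomp Require Import boolp classical_sets reals.
From mathcomp Require Import all_boot all_order all_algebra.
From mathcomp Require Import lra.

(** The coefficient of a matroid [n] in the antipode of [m] is the sum of
    [(-1) ^+ k] over the ordered decompositions [S_1, ..., S_k] of [I] for which
    the direct sum of the successive restrictions to the blocks, each taken
    after contracting the previous blocks, is [n]. Geometrically these
    decompositions are the braid cones that tile the open normal cone of the
    face [n], a cone of dimension [c(n)], and the sum is its Euler
    characteristic. The proof replaces this topology by an induction on [I].

    A set [S] can be the first block exactly when [n] splits as a direct sum
    along [S] and [m] and [n] have the same restriction to [S]; such an [S] is
    called tight ([flag_bases_cons]). The remaining blocks then form a
    decomposition for the part of [n] outside [S] inside the contraction of [m]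
    by [S], and this part is a face of the contraction if and only if [n] is a
    face of [m] ([optimal_face_contract], [optimal_face_of_contract]). Hence, if
    [n] is not a face, the coefficient is 0. If it is one, induction gives the
    coefficient as minus the sum, over the nonempty tight [S], of the sign
    [(-1) ^+ j] with [j] the number of components of [n] outside [S]. Tight sets
    are unions of components of [n], they are closed under disjoint union
    ([tightU]), and a separator of [n] inside a tight set is tight
    ([tight_subset]). The top level set of a weight that defines the face [n] is
    tight ([optimal_face_tight]), so some component [C] is tight. Adding or
    removing [C] is a sign-reversing involution on all tight sets, so
    the sum with [S = set0] included vanishes ([alternating_sum_tight]), and
    what remains is the sign of the number of components of [n]
    ([signed_count_flags]).

    Two translations complete the argument. The faces of the matroid polytope
    are the families of bases of maximal weight ([matroid_faceP]), because the
    indicators of the bases are its vertices. The maximal direct sum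
    decomposition of [n] is the partition of [I] into the smallest sets along
    which [n] splits ([num_componentsE]). *)

Set Implicit Arguments.
Unset Strict Implicit.
Unset Printing Implicit Defensive.

Import Order.TTheory GRing.Theory Num.Theory.
Local Open Scope ring_scope.

(** * Separators and components of a family of sets *)

Section Separators.
Variable T : finType.
Implicit Types (U S I b : {set T}) (B N : {set {set T}}) (e f : T).

Definition mix U b b' : {set T} := (b :&: U) :|: (b' :\: U).

Lemma in_mix U b b' z : (z \in mix U b b') = if z \in U then z \in b else z \in b'.
Proof. by rewrite !inE; case: (z \in U); rewrite ?andbT ?andbF ?orbF. Qed.

(** For the bases of a matroid this says that the matroid is the direct sum of
    its restrictions to [U] and to the complement of [U]. It involves no ranks,
    and the separators of any family form a Boolean algebra. *)
Definition separator N U := [forall b in N, forall b' in N, mix U b b' \in N].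

Lemma separatorP N U :
  reflect (forall b b', b \in N -> b' \in N -> mix U b b' \in N) (separator N U).
Proof.
apply: (iffP forall_inP) => [sep b b' bN | sep b bN].
  by move: (sep b bN) => /forall_inP; apply.
by apply/forall_inP => b'; apply: sep.
Qed.

Definition trace N S := [set b :&: S | b in N].
Definition cotrace N S := [set b :\: S | b in N].

Lemma mem_trace N S b : b \in N -> b :&: S \in trace N S.
Proof. exact: imset_f. Qed.

Lemma mem_cotrace N S b : b \in N -> b :\: S \in cotrace N S.
Proof. exact: imset_f. Qed.

Lemma separatorC N U : separator N U -> separator N (~: U).
Proof.
move=> /separatorP sep; apply/separatorP=> b b' bN b'N.
suff -> : mix (~: U) b b' = mix U b' b by apply: sep.
by apply/setP=> z; rewrite !in_mix !inE; case: (z \in U).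
Qed.

Lemma separatorI N U V : separator N U -> separator N V -> separator N (U :&: V).
Proof.
move=> /separatorP sU /separatorP sV; apply/separatorP=> b b' bN b'N.
suff -> : mix (U :&: V) b b' = mix V (mix U b b') b' by apply/sV/b'N/sU.
by apply/setP=> z; rewrite !in_mix !inE; case: (z \in U); case: (z \in V).
Qed.

Lemma separatorU N U V : separator N U -> separator N V -> separator N (U :|: V).
Proof.
move=> sU sV; rewrite -[U :|: V]setCK setCU.
by apply/separatorC/separatorI; apply: separatorC.
Qed.

Lemma separatorD N U V : separator N U -> separator N V -> separator N (U :\: V).
Proof. by move=> sU sV; rewrite setDE separatorI ?separatorC. Qed.

Lemma separator0 N : separator N set0.
Proof.
apply/separatorP=> b b' _ b'N.
by suff -> : mix set0 b b' = b' by []; apply/setP=> z; rewrite in_mix inE.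
Qed.

Lemma separator_ground N U : (forall b, b \in N -> b \subset U) -> separator N U.
Proof.
move=> NU; apply/separatorP=> b b' bN b'N.
suff -> : mix U b b' = b by [].
apply/setP=> z; rewrite in_mix; case: ifPn => // zU.
by rewrite (contraNF (subsetP (NU _ b'N) z) zU) (contraNF (subsetP (NU _ bN) z) zU).
Qed.

Lemma separator_trace N S U : separator N U -> separator (trace N S) U.
Proof.
move=> /separatorP sep; apply/separatorP=> _ _ /imsetP[b bN ->] /imsetP[b' b'N ->].
apply/imsetP; exists (mix U b b'); first exact: sep.
by apply/setP=> z; rewrite !(in_mix, inE); case: ifP.
Qed.

Lemma separator_cotrace N S U : separator N U -> separator (cotrace N S) U.
Proof.
move=> /separatorP sep; apply/separatorP=> _ _ /imsetP[b bN ->] /imsetP[b' b'N ->].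
apply/imsetP; exists (mix U b b'); first exact: sep.
by apply/setP=> z; rewrite !(in_mix, inE); case: ifP.
Qed.

(** A family split by [S] is split by every set that splits its outer part:
    mix outside [S] first, then restore the trace on [S]. *)
Lemma separator_of_cotrace N S U : separator N S -> [disjoint U & S] ->
  separator (cotrace N S) U -> separator N U.
Proof.
move=> /separatorP sS dUS /separatorP sU; apply/separatorP=> b b' bN b'N.
have /imsetP[x xN xE] := sU _ _ (imset_f _ bN) (imset_f _ b'N).
suff -> : mix U b b' = mix S b' x by apply: sS.
apply/setP=> z; move/setP/(_ z): xE; rewrite !(in_mix, inE).
have [zU|zU] := boolP (z \in U); first by rewrite (disjointFr dUS zU).
by case: (z \in S).
Qed.

Definition component N e := \bigcap_(U | separator N U && (e \in U)) U.

Lemma component_sub N U e : separator N U -> e \in U -> component N e \subset U.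
Proof. by move=> sU eU; apply: bigcap_inf; rewrite sU. Qed.

Lemma mem_component N e : e \in component N e.
Proof. by apply/bigcapP => U /andP[]. Qed.

Lemma component_separator N e : separator N (component N e).
Proof.
apply: (big_ind (separator N)) => [||U /andP[]//]; last exact: separatorI.
by apply: separator_ground => b _; apply: subsetT.
Qed.

(** Separators are closed under complement, so components partition. *)
Lemma component_eq N e f : f \in component N e -> component N f = component N e.
Proof.
move=> fe; apply/eqP; rewrite eqEsubset component_sub ?component_separator //=.
apply: component_sub; first exact: component_separator.
apply: contraT => ef.
have /subsetP/(_ f fe) : component N e \subset ~: component N f.
  by apply: component_sub; rewrite ?inE // separatorC ?component_separator.
by rewrite inE mem_component.
Qed.

Lemma component_disjoint N S e : separator N S -> e \notin S ->
  [disjoint component N e & S].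
Proof.
by move=> sS eS; rewrite disjoints_subset component_sub ?separatorC ?inE.
Qed.

Lemma component_cotrace N S e : separator N S -> e \notin S ->
  component (cotrace N S) e = component N e.
Proof.
move=> sS eS; apply/eqP; rewrite eqEsubset; apply/andP; split.
  by apply: component_sub; rewrite ?mem_component ?separator_cotrace
    ?component_separator.
apply: component_sub; last exact: mem_component.
apply: (separator_of_cotrace sS); last exact: component_separator.
rewrite disjoints_subset component_sub ?inE //.
by apply: separator_ground => _ /imsetP[b _ ->]; rewrite setDE subsetIr.
Qed.

Definition component_set N I := component N @: I.

Lemma component_set_cotrace N S I : separator N S ->
  component_set (cotrace N S) (I :\: S) = component_set N (I :\: S).
Proof.
move=> sS; apply: eq_in_imset => e; rewrite inE => /andP[eS _].
exact: component_cotrace.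
Qed.

Lemma card_component_setD1 N S I e : separator N S ->
    e \in I -> e \notin S ->
  #|component_set N (I :\: S)| =
    #|component_set N (I :\: (S :|: component N e))|.+1.
Proof.
move=> sS eI eS; set J := I :\: (S :|: component N e).
have -> : component_set N (I :\: S) = component N e |: component_set N J.
  apply/setP=> C; rewrite in_setU1; apply/imsetP/orP => [[f]|].
    rewrite inE => /andP[fS fI] ->.
    have [fe|fe] := boolP (f \in component N e).
      by left; rewrite (component_eq fe).
    by right; apply/imset_f; rewrite !inE negb_or fS fe fI.
  case=> [/eqP ->|]; first by exists e; rewrite ?inE ?eS.
  case/imsetP=> f; rewrite !inE negb_or -andbA => /and3P[fS _ fI] ->.
  by exists f; rewrite ?inE ?fS.
rewrite cardsU1 (_ : _ \notin _) //; apply/imsetP => -[f].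
rewrite !inE negb_or -andbA => /and3P[_ fe _] E.
by rewrite E mem_component in fe.
Qed.

End Separators.

(** * Flags of restrictions and contractions *)

Section Tight.
Variable T : finType.
Implicit Types (U S I C b c x y : {set T}) (B N X Y : {set {set T}}).

Lemma restrict_bases_nonempty I B S : bases_axiom I B ->
  exists c, c \in restrict_bases B S.
Proof. by move=> Bax; case/bases_axiomP: (restrict_axiom (Matroid Bax) S). Qed.

Lemma indep_extend B S A : indep B A -> A \subset S ->
  exists2 c, c \in restrict_bases B S & A \subset c.
Proof.
move=> iA AS.
have /maxset_exists[c cmax Ac] : [pred C | indep B C && (C \subset S)] A.
  by rewrite /= iA.
by exists c; rewrite ?inE.
Qed.

Lemma indep_cap B b S : b \in B -> indep B (b :&: S).
Proof. by move=> bB; apply/exists_inP; exists b; rewrite ?subsetIl. Qed.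

Lemma card_indep I B S A c : bases_axiom I B -> indep B A -> A \subset S ->
  c \in restrict_bases B S -> (#|A| <= #|c|)%N.
Proof.
move=> Bax iA AS cR; have [d dR Ad] := indep_extend iA AS.
by rewrite -(card_restrict_bases Bax dR cR) subset_leq_card.
Qed.

Lemma restrict_bases_restrict B S C : C \subset S ->
  restrict_bases (restrict_bases B S) C = restrict_bases B C.
Proof.
move=> CS; apply/setP=> A; rewrite !inE; apply: maxset_eq => D /=.
have [DC|] := boolP (D \subset C); rewrite ?andbF // !andbT.
apply/exists_inP/exists_inP => -[c cB Dc].
  have [/exists_inP[b bB cb] _ _] := restrict_basesP cB.
  by exists b; rewrite ?(subset_trans Dc).
have iD : indep B D by apply/exists_inP; exists c.
have [d dR Dd] := indep_extend iD (subset_trans DC CS).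
by exists d.
Qed.

Lemma mem_contract_bases I B S c A : bases_axiom I B ->
    c \in restrict_bases B S ->
  (A \in contract_bases B S) = [disjoint A & S] && (A :|: c \in B).
Proof.
move=> Bax cR; rewrite inE; case: (boolP [disjoint A & S]) => //= dA.
apply/exists_inP/idP => [[c' c'R]|AcB]; last by exists c.
exact: restrict_bases_swap Bax cR c'R dA.
Qed.

Lemma setD_contract_bases I B S b : bases_axiom I B -> b \in B ->
  b :&: S \in restrict_bases B S -> b :\: S \in contract_bases B S.
Proof.
move=> Bax bB bR.
by rewrite (mem_contract_bases _ Bax bR) disjointsD setUC setID.
Qed.

(** Swapping the part of a basis inside a separator [C] keeps its size, so each
    trace on [C] has maximal size among the independent subsets of [C]. *)
Lemma restrict_bases_separator I N C : bases_axiom I N -> separator N C ->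
  restrict_bases N C = trace N C.
Proof.
move=> Nax /separatorP sC; apply/setP=> A; apply/idP/imsetP => [AR|[b bN ->]].
  have [/exists_inP[b bN Ab] _ _] := restrict_basesP AR.
  by exists b; rewrite // (restrict_capP AR bN Ab).
have [c cR bc] := indep_extend (indep_cap C bN) (subsetIr b C).
have [/exists_inP[b' b'N cb'] _ _] := restrict_basesP cR.
have cE := restrict_capP cR b'N cb'.
suff -> : b :&: C = c by [].
apply/eqP; rewrite eqEcard bc /=.
have := card_bases Nax (sC _ _ b'N bN) bN.
rewrite /mix cE cardsU_disjoint; last first.
  by rewrite disjoint_sym -cE; apply: disjointWr (subsetIr _ _) (disjointsD _ _).
by rewrite -(cardsID C b) => /addIn ->.
Qed.

Lemma trace_trace N S C : C \subset S -> trace (trace N S) C = trace N C.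
Proof.
move=> CS; rewrite /trace -imset_comp; apply: eq_imset => b /=.
by rewrite -setIA (setIidPr CS).
Qed.

(** The condition on the first block [S] of a flag of [B] whose sum is [N]. *)
Definition tight B N S := separator N S && (restrict_bases B S == trace N S).

Lemma tight_subset I B N S C : bases_axiom I B -> tight B N S ->
  C \subset S -> separator N C -> tight B N C.
Proof.
move=> Bax /andP[sS /eqP RS] CS sC; rewrite /tight sC /=.
rewrite -(restrict_bases_restrict B CS) RS -(trace_trace N CS).
rewrite (@restrict_bases_separator S) ?separator_trace // -RS.
exact: (restrict_axiom (Matroid Bax) S).
Qed.

Lemma tight0 I B N : bases_axiom I B -> N != set0 -> tight B N set0.
Proof.
move=> Bax /set0Pn[b0 b0N]; rewrite /tight separator0 /=.
have [c cR] := restrict_bases_nonempty set0 Bax.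
apply/eqP/setP=> A; apply/idP/imsetP => [AR|[b _ ->]].
  have [_ A0 _] := restrict_basesP AR.
  by exists b0; rewrite // setI0; apply/eqP; rewrite -subset0.
have [_ c0 _] := restrict_basesP cR.
by move: cR; rewrite setI0; move: c0; rewrite subset0 => /eqP->.
Qed.

(** A basis of the restriction to the union has at most the sum of the two
    ranks, which the members of [N] attain; at equality it is tight on each
    block, so the two halves come from members of [N] and can be mixed. *)
Lemma tightU I B N S1 S2 : bases_axiom I B -> {subset N <= B} ->
    tight B N S1 -> tight B N S2 -> [disjoint S1 & S2] ->
  tight B N (S1 :|: S2).
Proof.
move=> Bax NB /andP[sep1 /eqP R1] /andP[sep2 /eqP R2] d.
rewrite /tight separatorU //=.
have capU b : b :&: (S1 :|: S2) = (b :&: S1) :|: (b :&: S2) by rewrite setIUr.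
have dcap b b' : [disjoint b :&: S1 & b' :&: S2].
  exact: disjointWl (subsetIr _ _) (disjointWr (subsetIr _ _) d).
have capR1 b : b \in N -> b :&: S1 \in restrict_bases B S1.
  by move=> bN; rewrite R1 mem_trace.
have capR2 b : b \in N -> b :&: S2 \in restrict_bases B S2.
  by move=> bN; rewrite R2 mem_trace.
have bound b c : b \in N -> c \in restrict_bases B (S1 :|: S2) ->
  [/\ #|c| = #|c :&: S1| + #|c :&: S2|, #|c :&: S1| <= #|b :&: S1|
    & #|c :&: S2| <= #|b :&: S2|]%N.
  move=> bN cR; have [/exists_inP[b' b'B cb'] cS _] := restrict_basesP cR.
  have ic S : indep B (c :&: S).
    by apply/exists_inP; exists b'; rewrite // (subset_trans (subsetIl _ _)).
  split; first by rewrite -cardsU_disjoint // -capU (setIidPl cS).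
    exact: card_indep Bax (ic _) (subsetIr _ _) (capR1 _ bN).
  exact: card_indep Bax (ic _) (subsetIr _ _) (capR2 _ bN).
apply/eqP/setP=> c; apply/idP/imsetP => [cR|[b bN ->]]; last first.
  apply: (restrict_basesI Bax (indep_cap _ (NB _ bN)) (subsetIr _ _)).
  have [d' dR] := restrict_bases_nonempty (S1 :|: S2) Bax.
  exists d' => //; have [-> le1 le2] := bound _ _ bN dR.
  by rewrite capU cardsU_disjoint // leq_add.
have [a aR] := restrict_bases_nonempty S1 Bax.
move: aR; rewrite R1 => /imsetP[b bN _].
have [cE le1 le2] := bound _ _ bN cR.
have [/exists_inP[b' b'B cb'] cS _] := restrict_basesP cR.
have := card_indep Bax (indep_cap _ (NB _ bN)) (subsetIr _ _) cR.
rewrite capU cardsU_disjoint // cE => ge.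
have ic S : indep B (c :&: S).
  by apply/exists_inP; exists b'; rewrite // (subset_trans (subsetIl _ _)).
have c1R : c :&: S1 \in restrict_bases B S1.
  apply: (restrict_basesI Bax (ic _) (subsetIr _ _)).
  exists (b :&: S1); first exact: capR1.
  by rewrite -(leq_add2r #|c :&: S2|) (leq_trans _ ge) ?leq_add2l.
have c2R : c :&: S2 \in restrict_bases B S2.
  apply: (restrict_basesI Bax (ic _) (subsetIr _ _)).
  exists (b :&: S2); first exact: capR2.
  by rewrite -(leq_add2l #|c :&: S1|) (leq_trans _ ge) ?leq_add2r.
move: c1R c2R; rewrite R1 R2 => /imsetP[b1 b1N E1] /imsetP[b2 b2N E2].
exists (mix S1 b1 b2); first by move/separatorP: sep1; apply.
rewrite -[LHS](setIidPl cS) capU E1 E2; apply/setP=> z.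
rewrite !(in_mix, inE); case: (boolP (z \in S1)) => z1; rewrite ?andbF //=.
by rewrite (disjointFr d z1) andbF orbF.
Qed.

(** The bases of the product of the iterated coproduct along [s]. *)
Fixpoint flag_bases B (s : seq {set T}) : {set {set T}} :=
  if s is A :: s' then
    sum_bases (restrict_bases B A) (flag_bases (contract_bases B A) s')
  else [set set0].

Lemma bases_product_coproduct s I (sI : ordered_decomposition I s)
    (m : matroid I) :
  bases (product_basis sI (coproduct_basis s m)) = flag_bases (bases m) s.
Proof.
elim: s I sI m => [|S s IHs] I sI m //=.
by case: (ordered_decomposition_cons sI) => SI s'I /=; rewrite IHs.
Qed.

Lemma ordered_decomposition_consE I S s :
  ordered_decomposition I (S :: s) =
    [&& S != set0, S \subset I & ordered_decomposition (I :\: S) s].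
Proof.
apply/idP/and3P => [sI|[S0 SI]].
  have [SI s'I] := ordered_decomposition_cons sI.
  by move: sI => /and3P[/= /andP[]].
move=> /and3P[s0 ds /eqP sI]; apply/and3P; split; rewrite /= ?S0 // ?ds ?andbT.
  apply/allP=> S' S's; rewrite disjoint_sym disjoints_subset.
  have : S' \subset I :\: S by rewrite -sI bigcup_seq; apply: bigcup_sup.
  by move/subset_trans; apply; rewrite setDE subsetIr.
rewrite big_cons sI; apply/eqP/setP=> z; rewrite !inE.
by case: (boolP (z \in S)) => //= /(subsetP SI) ->.
Qed.

Lemma flag_bases_ground s I B : bases_axiom I B -> ordered_decomposition I s ->
  flag_bases B s != set0 /\ forall b, b \in flag_bases B s -> b \subset I.
Proof.
elim: s I B => [|S s IHs] I B Bax /=.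
  split; first by apply/set0Pn; exists set0; rewrite inE.
  by move=> b /set1P->; apply: sub0set.
rewrite ordered_decomposition_consE => /and3P[_ SI sI].
have [/set0Pn[y yF] Fsub] := IHs _ _ (contract_axiom (Matroid Bax) S) sI.
have [x xR] := restrict_bases_nonempty S Bax.
split; first by apply/set0Pn; exists (x :|: y); apply: imset2_f.
move=> _ /imset2P[c d /restrict_basesP[_ cS _] /Fsub dI ->].
by rewrite subUset (subset_trans cS) // (subset_trans dI) ?subsetDl.
Qed.

(** A direct sum determines its summands, which are its traces. *)
Lemma sum_bases_eq X Y N S : X != set0 -> Y != set0 ->
    (forall x, x \in X -> x \subset S) ->
    (forall y, y \in Y -> [disjoint y & S]) ->
  (sum_bases X Y == N) = [&& separator N S, X == trace N S & Y == cotrace N S].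
Proof.
move=> /set0Pn[x0 x0X] /set0Pn[y0 y0Y] XS YS.
have capE x y : x \in X -> y \in Y -> (x :|: y) :&: S = x.
  move=> xX yY; rewrite setIUl (setIidPl (XS _ xX)).
  by rewrite (disjoint_setI0 (YS _ yY)) setU0.
have diffE x y : x \in X -> y \in Y -> (x :|: y) :\: S = y.
  move=> xX yY; rewrite setDUl; move: (XS _ xX); rewrite -setD_eq0 => /eqP->.
  by rewrite set0U; apply/setDidPl; apply: YS.
apply/eqP/and3P => [<-|[/separatorP sep /eqP XE /eqP YE]].
  split.
  - apply/separatorP=> _ _ /imset2P[x y xX yY ->] /imset2P[x' y' x'X y'Y ->].
    by rewrite /mix capE // diffE // imset2_f.
  - apply/eqP/setP=> x; apply/idP/imsetP => [xX|[_ /imset2P[x' y x'X yY ->] ->]].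
      by exists (x :|: y0); rewrite ?imset2_f ?capE.
    by rewrite capE.
  - apply/eqP/setP=> y; apply/idP/imsetP => [yY|[_ /imset2P[x y' xX y'Y ->] ->]].
      by exists (x0 :|: y); rewrite ?imset2_f ?diffE.
    by rewrite diffE.
apply/setP=> b; apply/imset2P/idP => [[x y]|bN].
  by rewrite XE YE => /imsetP[b1 b1N ->] /imsetP[b2 b2N ->] ->; apply: sep.
by exists (b :&: S) (b :\: S); rewrite ?XE ?YE ?mem_trace ?mem_cotrace ?setID.
Qed.

Lemma flag_bases_cons I B N S s : bases_axiom I B ->
    ordered_decomposition (I :\: S) s ->
  (flag_bases B (S :: s) == N) =
    tight B N S && (flag_bases (contract_bases B S) s == cotrace N S).
Proof.
move=> Bax sI /=.
have [F0 Fsub] := flag_bases_ground (contract_axiom (Matroid Bax) S) sI.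
have [x xR] := restrict_bases_nonempty S Bax.
rewrite (@sum_bases_eq _ _ _ S) // ?andbA //.
- by apply/set0Pn; exists x.
- by move=> c /restrict_basesP[].
- by move=> y /Fsub; rewrite subsetD => /andP[].
Qed.

End Tight.

(** * Families maximizing a weight *)

Section Weights.
Variables (R : realDomainType) (T : finType).
Implicit Types (A S I b c : {set T}) (B N : {set {set T}}) (y : T -> R).

Definition weight y b : R := \sum_(i in b) y i.

Lemma weight_ID y S b : weight y b = weight y (b :&: S) + weight y (b :\: S).
Proof. by rewrite /weight (big_setID S). Qed.

(** For nonempty [N] this says that [N] is the set of members of [B] of maximal
    weight; in this form the maximum need not be named. *)
Definition maximizes B N y : Prop :=
  [/\ {subset N <= B}, forall b b', b \in B -> b' \in N -> weight y b <= weight y b'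
    & forall b b', b \in B -> b' \in N -> weight y b' <= weight y b -> b \in N].

Definition optimal_face B N : Prop := N != set0 /\ exists y, maximizes B N y.

Lemma optimal_face_contract I B N S : bases_axiom I B -> tight B N S ->
  optimal_face B N -> optimal_face (contract_bases B S) (cotrace N S).
Proof.
move=> Bax /andP[_ /eqP RS] [N0 [y [NB leN eqN]]].
have /set0Pn[b0 b0N] := N0.
have capR b : b \in N -> b :&: S \in restrict_bases B S.
  by move=> bN; rewrite RS mem_trace.
have wU A b : [disjoint A & S] ->
    weight y (A :|: b :&: S) = weight y A + weight y (b :&: S).
  move=> dA; rewrite (weight_ID y S) addrC setIUl (disjoint_setI0 dA) set0U.
  by rewrite -setIA setIid setDUl setDIl setDv setI0 setU0 (setDidPl dA).
split; first by apply/set0Pn; exists (b0 :\: S); apply: mem_cotrace.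
have liftA A b : A \in contract_bases B S -> b \in N ->
    [disjoint A & S] /\ A :|: b :&: S \in B.
  by move=> + bN; rewrite (mem_contract_bases A Bax (capR b bN)) => /andP[].
exists y; split=> [_ /imsetP[b bN ->]|A _ AC /imsetP[b bN ->]
  |A _ AC /imsetP[b bN ->] le_A].
- by apply: (setD_contract_bases Bax); rewrite ?NB ?capR.
- have [dA AB] := liftA _ _ AC bN.
  by have := leN _ _ AB bN; rewrite wU // (weight_ID y S b) addrC lerD2l.
- have [dA AB] := liftA _ _ AC bN.
  apply/imsetP; exists (A :|: b :&: S); last first.
    by rewrite setDUl setDIl setDv setI0 setU0 (setDidPl dA).
  by apply: (eqN _ b AB bN); rewrite wU // (weight_ID y S b) addrC lerD2r.
Qed.

Lemma lt_gap (k u v p q : R) : u <= k -> - k <= v -> 0 <= q ->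
  p + u < p + (1 + k + k) + q + v.
Proof. by lra. Qed.

(** A maximizing weight for the contraction becomes one for [B] once a constant
    [K] exceeding the difference of any two of its values is put on [S]: the
    bases of maximal weight must then have maximal size inside [S]. *)
Lemma optimal_face_of_contract I B N S : bases_axiom I B -> tight B N S ->
  optimal_face (contract_bases B S) (cotrace N S) -> optimal_face B N.
Proof.
move=> Bax /andP[/separatorP sep /eqP RS] [C0 [y [CB leC eqC]]].
have /set0Pn[_ /imsetP[b0 b0N _]] := C0.
pose M := \sum_i `|y i|; pose K := 1 + M + M.
pose w i := if i \in S then K else y i.
have wE b : weight w b = K *+ #|b :&: S| + weight y (b :\: S).
  rewrite (weight_ID w S); congr (_ + _).
    rewrite -sumr_const; apply: eq_bigr => i.
    by rewrite /w inE => /andP[_ ->].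
  by apply: eq_bigr => i; rewrite /w inE => /andP[/negbTE-> _].
have boundM b : `|weight y b| <= M.
  apply: le_trans (ler_norm_sum _ _ _) _.
  by rewrite /M [leRHS](bigID (mem b)) /= lerDl sumr_ge0.
have NE b : (b \in N) = (b :&: S \in trace N S) && (b :\: S \in cotrace N S).
  apply/idP/andP => [bN|[/imsetP[b1 b1N E1] /imsetP[b2 b2N E2]]].
    by rewrite mem_trace ?mem_cotrace.
  by rewrite -[b](setID _ S) E1 E2; apply: sep.
have NB b : b \in N -> b \in B.
  move=> bN; have := CB _ (mem_cotrace S bN).
  rewrite (@mem_contract_bases _ _ _ _ (b :&: S) _ Bax) ?RS ?mem_trace //.
  by rewrite setUC setID => /andP[].
have tightN b b' : b \in B -> b' \in N -> weight w b' <= weight w b ->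
    #|b :&: S| = #|b' :&: S|.
  move=> bB b'N; have b'R : b' :&: S \in restrict_bases B S.
    by rewrite RS mem_trace.
  have := card_indep Bax (indep_cap S bB) (subsetIr _ _) b'R.
  rewrite leq_eqVlt => /orP[/eqP //|ltc]; rewrite leNgt => /negP[].
  rewrite !wE -(subnKC ltc) mulrnDr mulrS.
  have K0 : 0 <= K *+ (#|b' :&: S| - #|b :&: S|.+1).
    by rewrite mulrn_wge0 // !addr_ge0 ?sumr_ge0.
  have := boundM (b :\: S); have := boundM (b' :\: S).
  rewrite !ler_norml => /andP[h1 _] /andP[_ h2].
  by rewrite [K + _]addrC lt_gap.
have capR b b' : b \in B -> b' \in N -> #|b :&: S| = #|b' :&: S| ->
    b :&: S \in restrict_bases B S.
  move=> bB b'N eqc; apply: (restrict_basesI Bax (indep_cap S bB) (subsetIr _ _)).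
  by exists (b' :&: S); rewrite ?eqc ?RS ?mem_trace.
split; first by apply/set0Pn; exists b0.
exists w; split=> // b b' bB b'N.
  case: (leP (weight w b) (weight w b')) => // lt_w.
  have eqc := tightN _ _ bB b'N (ltW lt_w).
  have bC := setD_contract_bases Bax bB (capR _ _ bB b'N eqc).
  by move: lt_w; rewrite !wE eqc ltrD2l ltNge leC ?mem_cotrace.
move=> le_w; have eqc := tightN _ _ bB b'N le_w.
have bR := capR _ _ bB b'N eqc.
have bC := setD_contract_bases Bax bB bR.
rewrite NE -RS bR /=; apply: (eqC _ _ bC (mem_cotrace S b'N)).
by move: le_w; rewrite !wE eqc lerD2l.
Qed.

(** Replace the part of a maximizing [b] inside the top level set [S] by any
    basis [c] of the restriction to [S] (extending [c] from [b]): nothing of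
    weight below the top is gained, so the weight cannot drop. *)
Lemma optimal_face_tight I B N y e : bases_axiom I B -> N != set0 ->
    maximizes B N y -> e \in I ->
  exists2 S, tight B N S & (S \subset I) && (S != set0).
Proof.
move=> Bax N0 [NB leN eqN] eI.
have /set0Pn[b0 b0N] := N0.
case: (@arg_maxP _ R T e (mem I) y eI) => t tI tmax.
pose S := [set i in I | y i == y t].
have tS : t \in S by rewrite inE eqxx andbT.
have key b c : b \in N -> c \in restrict_bases B S ->
    #|c| = #|b :&: S| /\ c :|: (b :\: S) \in N.
  move=> bN cR; have [ic cS _] := restrict_basesP cR.
  have bB := NB b bN.
  have [b' [b'B cb' b's]] := extend_basis Bax ic bB.
  have b'S := restrict_capP cR b'B cb'.
  have b'D : b' :\: S \subset b :\: S.
    apply/subsetP=> z; rewrite inE => /andP[zS zb'].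
    rewrite inE zS; move: (subsetP b's z zb'); rewrite inE.
    by case/orP=> // /(subsetP cS); rewrite (negbTE zS).
  have [_ BI _] := bases_axiomP _ _ Bax.
  pose y' i := y i - y t.
  have wy' a : weight y a = weight y' (a :\: S) + y t *+ #|a|.
    rewrite -[RHS](add0r _) -[0](_ : weight y' (a :&: S) = 0); last first.
      by apply: big1 => i; rewrite !inE /y' => /and3P[_ _ /eqP->]; rewrite subrr.
    by rewrite addrA -weight_ID /weight sumrB sumr_const subrK.
  have DE : b :\: S = b' :\: S.
    apply/eqP; rewrite eqEsubset b'D andbT -setD_eq0 -cards_eq0 -leqn0 leqNgt.
    apply/negP => /card_gt0P[z zD]; have := leN _ _ b'B bN; rewrite leNgt => /negP[].
    rewrite !wy' (card_bases Bax b'B bB) ltrD2r.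
    rewrite (weight_ID y' (b' :\: S) (b :\: S)) (setIidPr b'D) gtrDl.
    have neg i : i \in (b :\: S) :\: (b' :\: S) -> y' i < 0.
      rewrite in_setD => /andP[_]; rewrite in_setD => /andP[+ /(subsetP (BI _ bB)) iI].
      by rewrite inE iI /= subr_lt0 lt_neqAle => ->; apply: tmax.
    rewrite /weight (bigD1 z) //= -[ltRHS]addr0 ltr_leD ?neg //.
    by apply: sumr_le0 => i /andP[/neg/ltW].
  have b'E : c :|: (b :\: S) = b' by rewrite DE -b'S setID.
  split; last first.
    rewrite b'E; apply: (eqN _ b b'B bN).
    by rewrite !wy' DE (card_bases Bax b'B bB).
  apply: (@addIn #|b :\: S|); rewrite cardsID -(card_bases Bax b'B bB).
  by rewrite DE -b'S cardsID.
have capR b : b \in N -> b :&: S \in restrict_bases B S.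
  move=> bN; have [c cR] := restrict_bases_nonempty S Bax.
  apply: (restrict_basesI Bax (indep_cap S (NB _ bN)) (subsetIr _ _)).
  by exists c => //; have [-> _] := key _ _ bN cR.
exists S; last first.
  apply/andP; split; first by apply/subsetP=> i /setIdP[].
  by apply/set0Pn; exists t.
apply/andP; split.
  by apply/separatorP=> b b' bN b'N; case: (key _ _ b'N (capR _ bN)).
apply/eqP/setP=> c; apply/idP/imsetP => [cR|[b bN ->]]; last exact: capR.
have [_ cN] := key _ _ b0N cR; exists (c :|: b0 :\: S) => //.
have [_ cS _] := restrict_basesP cR.
by rewrite setIUl (setIidPl cS) (disjoint_setI0 (disjointsD _ _)) setU0.
Qed.

End Weights.

(** * The signed count of flags *)

Section SignedCount.
Variables (R : realDomainType) (K : nzRingType) (T : finType).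
Implicit Types (S I b c : {set T}) (B N : {set {set T}}).

Lemma sum_tuple0 (X : finType) (P : pred (seq X)) (c : K) :
  \sum_(s : 0.-tuple X | P s) c = if P [::] then c else 0.
Proof.
rewrite big_mkcond (bigD1 [tuple]) //= big1 ?addr0 // => s /negP[].
by apply/eqP; apply: tuple0.
Qed.

Lemma sum_tuple_cons (X : finType) k (P : pred (seq X)) (c : K) :
  \sum_(s : k.+1.-tuple X | P s) c =
    \sum_(x : X) \sum_(s : k.-tuple X | P (x :: s)) c.
Proof.
rewrite pair_big_dep /=.
rewrite (reindex (fun p : X * k.-tuple X => [tuple of p.1 :: p.2])) //.
exists (fun s : k.+1.-tuple X => (thead s, [tuple of behead s])).
  by move=> [x s] _; congr pair => /=; apply/val_inj.
by move=> s _; apply/val_inj; rewrite /= [in RHS](tuple_eta s).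
Qed.

(** Some component [C] is tight, being part of the top level set of a weight
    that defines the face. Adding or removing [C] pairs up the tight sets and
    changes the number of components outside by one. *)
Lemma alternating_sum_tight I B N : bases_axiom I B -> I != set0 ->
    optimal_face R B N ->
  \sum_(S : {set T} | (S \subset I) && tight B N S)
     (-1) ^+ #|component_set N (I :\: S)| = 0 :> K.
Proof.
move=> Bax /set0Pn[i iI] [N0 [y yN]].
have [S0 tS0 /andP[S0I /set0Pn[e eS0]]] := optimal_face_tight Bax N0 yN iI.
have [NB _ _] := yN; have [_ BI _] := bases_axiomP _ _ Bax.
have sI : separator N I by apply: separator_ground => b /NB/BI.
pose C := component N e.
have sC : separator N C := component_separator N e.
have eC : e \in C := mem_component N e.
have CS S : tight B N S -> e \in S -> C \subset S.
  by move=> /andP[sS _]; apply: component_sub.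
have tC : tight B N C by apply: (tight_subset Bax tS0) (CS _ tS0 eS0) sC.
have CI : C \subset I := subset_trans (CS _ tS0 eS0) S0I.
have eI : e \in I := subsetP CI e eC.
rewrite (bigID (fun S : {set T} => e \in S)) /=.
rewrite (reindex_onto (fun S => S :|: C) (fun S => S :\: C)) /=; last first.
  move=> S /andP[/andP[_ tS] eS].
  by rewrite setUC -[in RHS](setID S C) (setIidPr _) // CS.
rewrite (eq_bigl (fun S => (S \subset I) && tight B N S && (e \notin S))); last first.
  move=> S; apply/idP/idP.
    move=> /andP[/andP[/andP[SI tS] _] /eqP SE].
    have eS : e \notin S by rewrite -SE inE eC.
    rewrite eS andbT (subset_trans (subsetUl S C) SI) /=.
    apply: (tight_subset Bax tS (subsetUl S C)).
    by rewrite -SE separatorD //; case/andP: tS.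
  move=> /andP[/andP[SI tS] eS].
  have dSC : [disjoint S & C].
    by rewrite disjoint_sym component_disjoint //; case/andP: tS.
  rewrite subUset SI CI inE eC orbT (tightU Bax) //=.
  by rewrite setDUl setDv setU0 (setDidPl dSC).
rewrite -big_split big1 //= => S /andP[/andP[_ /andP[sS _]] eS].
by rewrite (card_component_setD1 sS eI eS) exprS mulN1r subrr.
Qed.

Lemma bases_axiom_set0 B : bases_axiom set0 B -> B = [set set0].
Proof.
case/bases_axiomP=> [[b0 b0B] B0 _].
have BE b : b \in B -> b = set0 by move=> /B0; rewrite subset0 => /eqP.
apply/setP=> b; rewrite inE; apply/idP/eqP => [/BE //|->].
by rewrite -(BE b0 b0B).
Qed.

Lemma optimal_face_set0 N : optimal_face R [set set0] N <-> N = [set set0].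
Proof.
split=> [[/set0Pn[b bN] [y [NB _ _]]]|->].
  apply/eqP; rewrite eqEsubset sub1set -{2}(set1P (NB _ bN)) bN andbT.
  exact/subsetP.
split; first by apply/set0Pn; exists set0; rewrite inE.
by exists (fun=> 0); split=> // b b' /set1P-> /set1P->.
Qed.

Lemma ordered_decomposition_nil I :
  ordered_decomposition I [::] = (I == set0).
Proof. by rewrite /ordered_decomposition /= big_nil eq_sym. Qed.

Lemma signed_count_flags_set0 n B N : bases_axiom set0 B ->
  \sum_(0 <= k < n.+1) \sum_(s : k.-tuple {set T} |
      ordered_decomposition set0 s && (flag_bases B s == N)) (-1) ^+ k =
    (N == [set set0])%:R :> K.
Proof.
move=> Bax; rewrite big_nat_recl //=.
rewrite (sum_tuple0 (fun s => ordered_decomposition _ s && (flag_bases B s == N))).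
rewrite ordered_decomposition_nil eqxx /= big1 ?addr0 => [|k _]; last first.
  apply: big_pred0 => s; rewrite (tuple_eta s) ordered_decomposition_consE subset0.
  by case: eqP.
by rewrite eq_sym; case: eqP.
Qed.

(** The first block [S] of a flag of [B] with sum [N] is a nonempty tight set,
    and the rest is a flag of the contraction by [S] with sum the outer part of
    [N]. By induction these rests contribute the sign of the components of [N]
    outside [S]; the sum of these signs over all tight [S] vanishes, which
    leaves the opposite of the missing term [S = set0]. *)
Lemma signed_count_flags n I B N : (#|I| <= n)%N -> bases_axiom I B ->
  \sum_(0 <= k < n.+1) \sum_(s : k.-tuple {set T} |
      ordered_decomposition I s && (flag_bases B s == N)) (-1) ^+ k =
    if `[< optimal_face R B N >] then (-1) ^+ #|component_set N I| else 0 :> K.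
Proof.
have count0 k B' N' : bases_axiom set0 B' ->
    \sum_(0 <= k < k.+1) \sum_(s : k.-tuple {set T} |
        ordered_decomposition set0 s && (flag_bases B' s == N')) (-1) ^+ k =
      if `[< optimal_face R B' N' >] then (-1) ^+ #|component_set N' set0| else 0 :> K.
  move=> B'ax; rewrite signed_count_flags_set0 // /component_set imset0 cards0.
  rewrite (bases_axiom_set0 B'ax).
  case: asboolP => [/optimal_face_set0 ->|nF]; first by rewrite eqxx.
  by case: eqP => // /optimal_face_set0.
elim: n I B N => [|n IHn] I B N leI Bax; have [I0|I0] := eqVneq I set0.
- by rewrite I0 in Bax *; apply: count0.
- by move: leI; rewrite leqn0 cards_eq0 (negbTE I0).
- by rewrite I0 in Bax *; apply: count0.
rewrite big_nat_recl // /=.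
rewrite (sum_tuple0 (fun s => ordered_decomposition _ s && (flag_bases B s == N))).
rewrite ordered_decomposition_nil (negbTE I0) /= add0r.
pose rest S := if `[< optimal_face R (contract_bases B S) (cotrace N S) >]
  then (-1) ^+ #|component_set (cotrace N S) (I :\: S)| else 0 : K.
transitivity (\sum_(S : {set T} | ((S \subset I) && tight B N S) && (S != set0))
    - rest S).
  under eq_bigr => k _ do
    rewrite (sum_tuple_cons _ (fun s => ordered_decomposition I s
      && (flag_bases B s == N))).
  rewrite exchange_big [RHS]big_mkcond /=; apply: eq_bigr => S _.
  case: ifPn => [/andP[/andP[SI tS] S0]|nS].
    have leIS : (#|I :\: S| <= n)%N.
      rewrite -ltnS; apply: leq_trans leI; rewrite -(cardsID S I) (setIidPr SI).
      by rewrite -add1n leq_add2r card_gt0.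
    have Cax : bases_axiom (I :\: S) (contract_bases B S).
      exact: contract_axiom (Matroid Bax) S.
    rewrite /rest -(IHn _ _ (cotrace N S) leIS Cax) -sumrN.
    apply: eq_bigr => k _; rewrite -sumrN.
    apply: eq_big => [s|s _]; last by rewrite exprS mulN1r.
    rewrite ordered_decomposition_consE S0 SI /=.
    case: (boolP (ordered_decomposition _ _)) => //= sI.
    by rewrite (flag_bases_cons N Bax sI) tS.
  apply: big1 => k _; apply: big_pred0 => s; apply: contraNF nS => /andP[].
  rewrite ordered_decomposition_consE => /and3P[-> -> sI].
  by rewrite (flag_bases_cons N Bax sI) => /andP[->].
case: asboolP => [fN|nfN]; last first.
  apply: big1 => S /andP[/andP[SI tS] _]; rewrite /rest asboolF ?oppr0 //.
  by move/(optimal_face_of_contract Bax tS).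
have [N0 _] := fN.
have := alternating_sum_tight Bax I0 fN.
rewrite (bigD1 set0) ?sub0set ?(tight0 Bax) //= setD0 => /eqP.
rewrite addr_eq0 => /eqP->; rewrite -sumrN; apply: eq_bigr => S.
move=> /andP[/andP[SI tS] _]; rewrite /rest asboolT; last first.
  exact: optimal_face_contract Bax tS fN.
by rewrite component_set_cotrace //; case/andP: tS.
Qed.

End SignedCount.

(** * The number of connected components *)

Section Components.
Variable T : finType.
Implicit Types (S I b : {set T}) (N P Q : {set {set T}}) (r : seq {set T}).

Lemma mem_big_sum_bases r (F : {set T} -> {set {set T}}) b :
    pairwise (fun S S' => [disjoint S & S']) r ->
    (forall S x, x \in F S -> x \subset S) ->
  (b \in \big[@sum_bases T/[set set0]]_(S <- r) F S) =
    (b \subset \bigcup_(S <- r) S) && all (fun S => b :&: S \in F S) r.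
Proof.
move=> + FS; elim: r b => [|S r IHr] b /=.
  by rewrite !big_nil inE andbT subset0.
rewrite !big_cons => /andP[dS dr]; set W := \bigcup_(S <- r) S.
have dSW : [disjoint W & S].
  rewrite disjoint_sym /W bigcup_seq; apply/bigcup_disjointP=> S' S'r.
  exact: (allP dS).
have WS S' : S' \in r -> S' \subset W by rewrite /W bigcup_seq => /bigcup_sup; apply.
apply/imset2P/and3P => [[x y xF yF ->]|[bW bS br]].
  move: yF; rewrite IHr // => /andP[yW /allP yr].
  have xS := FS _ _ xF.
  split; first exact: setUSS.
    rewrite setIUl (setIidPl xS) (disjoint_setI0 (disjointWl yW dSW)).
    by rewrite setU0.
  apply/allP=> S' S'r; rewrite setIUl (_ : x :&: S' = set0) ?set0U ?yr //.
  by apply: disjoint_setI0; apply: disjointWl xS (allP dS _ S'r).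
exists (b :&: S) (b :\: S); rewrite ?setID // IHr //; apply/andP; split.
  apply/subsetP=> z; rewrite inE => /andP[zS /(subsetP bW)].
  by rewrite inE (negbTE zS).
apply/allP=> S' S'r; move/allP: br => /(_ S' S'r).
rewrite setIDAC [_ :\: S](_ : _ = b :&: S') //.
apply/setDidPl; rewrite disjoint_sym.
exact: disjointWr (subsetIr _ _) (allP dS _ S'r).
Qed.

(** Members of [N] can be glued along finitely many separators. *)
Lemma glue_separators N r b : N != set0 ->
    (forall S, S \in r -> separator N S /\ b :&: S \in trace N S) ->
  exists2 b', b' \in N & b' :&: \bigcup_(S <- r) S = b :&: \bigcup_(S <- r) S.
Proof.
move=> /set0Pn[b0 b0N]; elim: r => [|S r IHr] rP.
  by exists b0; rewrite // big_nil !setI0.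
have [|b' b'N E] := IHr; first by move=> S' S'r; apply: rP; rewrite inE S'r orbT.
have [/separatorP sS /imsetP[b1 b1N E1]] := rP S (mem_head _ _).
exists (mix S b1 b'); first exact: sS.
rewrite big_cons; apply/setP=> z; move/setP/(_ z): E; move/setP/(_ z): E1.
by rewrite !inE; case: (z \in S); rewrite ?andbT ?andbF ?orbF //= => ->.
Qed.

Lemma trivIset_pairwise P r : trivIset P -> uniq r -> {subset r <= P} ->
  pairwise (fun S S' => [disjoint S & S']) r.
Proof.
move=> /trivIsetP tP; elim: r => //= S r IHr /andP[Sr ur] rP.
rewrite IHr // ?andbT => [|S' S'r]; last by apply: rP; rewrite inE S'r orbT.
apply/allP=> S' S'r; apply: tP; rewrite ?rP ?inE ?eqxx ?S'r ?orbT //.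
by apply: contraNneq Sr => ->.
Qed.

Lemma mem_sum_partition P I (F : {set T} -> {set {set T}}) b :
    partition P I -> (forall S x, x \in F S -> x \subset S) ->
  (b \in \big[@sum_bases T/[set set0]]_(S in P) F S) =
    (b \subset I) && [forall S in P, b :&: S \in F S].
Proof.
move=> /and3P[/eqP <- tP _] FS; rewrite -big_filter.
set r := filter _ _; have rE : r =i P.
  by move=> S; rewrite mem_filter mem_index_enum andbT.
rewrite mem_big_sum_bases //; last first.
  apply: (trivIset_pairwise tP) => [|S]; last by rewrite rE.
  exact/filter_uniq/index_enum_uniq.
rewrite bigcup_seq (eq_bigl _ _ rE); congr (_ && _).
by apply/allP/forall_inP=> H S SP; apply: H; rewrite ?rE // -rE.
Qed.

(** For one direction the summands are the restrictions to the blocks: as the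
    blocks are separators, bases of the restrictions come from members of the
    family, which can be glued. *)
Lemma is_direct_sumP I (m : matroid I) P :
  is_direct_sum m P <->
    partition P I /\ forall S, S \in P -> separator (bases m) S.
Proof.
have [N0 NI _] := bases_axiomP _ _ (basesP m).
split=> [[PI [n E]]|[PI sP]]; split=> //; last first.
  exists (restrict m); apply/setP=> b; rewrite (mem_sum_partition _ PI) //; last first.
    by move=> S x /restrict_basesP[].
  apply/idP/andP => [bN|[bI /forall_inP bP]].
    split; first exact: NI.
    apply/forall_inP=> S /sP sS /=.
    by rewrite (restrict_bases_separator (basesP m) sS) mem_trace.
  have [||b' b'N] := @glue_separators (bases m) (enum P) b; first exact/set0Pn.
    move=> S; rewrite mem_enum => SP; split; first exact: sP.
    by rewrite -(restrict_bases_separator (basesP m) (sP _ SP)); apply: bP.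
  have -> : \bigcup_(S <- enum P) S = I.
    by rewrite bigcup_seq -(cover_partition PI); apply: eq_bigl => S; rewrite mem_enum.
  by rewrite (setIidPl bI) (setIidPl (NI _ b'N)) => <-.
have nS S x : x \in bases (n S) -> x \subset S.
  by have [_ + _] := bases_axiomP _ _ (basesP (n S)); apply.
move=> S SP; apply/separatorP=> b b'.
rewrite E !(mem_sum_partition _ PI) //.
move=> /andP[bI /forall_inP bP] /andP[b'I /forall_inP b'P]; apply/andP; split.
  apply/subsetP=> z; rewrite in_mix.
  by case: ifP => _; [apply: (subsetP bI) | apply: (subsetP b'I)].
apply/forall_inP=> S' S'P; have [->|neq] := eqVneq S' S.
  suff -> : mix S b b' :&: S = b :&: S by apply: bP.
  by apply/setP=> z; rewrite in_setI in_mix in_setI; case: (z \in S); rewrite ?andbF.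
suff -> : mix S b b' :&: S' = b' :&: S' by apply: b'P.
case/and3P: PI => _ /trivIsetP/(_ _ _ S'P SP neq) d _.
apply/setP=> z; rewrite !in_setI in_mix.
by case: (boolP (z \in S')) => z'; rewrite ?andbF // (disjointFr d z').
Qed.

Lemma component_set_partition N I : separator N I ->
  partition (component_set N I) I.
Proof.
move=> sI; apply/and3P; split.
- apply/eqP/setP=> z; apply/bigcupP/idP => [[_ /imsetP[e eI ->]]|zI].
    exact: (subsetP (component_sub sI eI)).
  by exists (component N z); [apply: imset_f | apply: mem_component].
- apply/trivIsetP=> _ _ /imsetP[e _ ->] /imsetP[f _ ->]; apply: contraR.
  move=> /pred0Pn[z /= /andP[ze zf]].
  by rewrite -(component_eq ze) (component_eq zf).
- by apply/imsetP=> -[e _ E]; have := mem_component N e; rewrite -E inE.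
Qed.

(** Every block of a decomposition is a separator, hence a union of components;
    the partition into components thus refines all decompositions. *)
Lemma num_componentsE I (m : matroid I) :
  num_components m = #|component_set (bases m) I|.
Proof.
have [_ NI _] := bases_axiomP _ _ (basesP m).
set P := component_set _ _; have sI := separator_ground NI.
have PI : partition P I := component_set_partition sI.
have Pds : is_direct_sum m P.
  apply/is_direct_sumP; split=> // _ /imsetP[e _ ->]; exact: component_separator.
congr #|pred_of_set _|; apply: xget_unique.
  split=> // Q /is_direct_sumP[QI sQ] /forall_inP QP.
  have inQ S f : S \in Q -> f \in S -> component (bases m) f = S.
    move=> SQ fS; apply/eqP; rewrite eqEsubset component_sub ?sQ //=.
    have /exists_inP[_ /imsetP[e _ ->] Se] := QP _ SQ.
    by rewrite (component_eq (subsetP Se f fS)).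
  have QIE := cover_partition QI.
  apply/setP=> S; apply/idP/imsetP => [SQ|[e]].
    have /set0Pn[f fS] : S != set0.
      by apply: contraTneq SQ => ->; case/and3P: QI.
    exists f; last by rewrite (inQ S).
    by rewrite -QIE; apply/bigcupP; exists S.
  rewrite -{1}QIE => /bigcupP[S' S'Q eS'] ->.
  by rewrite (inQ S').
move=> Q [/is_direct_sumP[QI sQ] Qmax]; apply/esym/Qmax => //.
apply/forall_inP=> _ /imsetP[e + ->].
rewrite -{1}(cover_partition QI) => /bigcupP[S SQ eS].
by apply/exists_inP; exists S; rewrite // component_sub ?sQ.
Qed.

End Components.

(** * Faces of the matroid polytope *)

Section Faces.
Variables (R : realType) (T : finType) (I : {set T}).
Implicit Types (m n : matroid I) (b : {set T}) (x y : {ffun T -> R^o}).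

Lemma pairing_indicator y b : pairing y (indicator R b) = weight y b.
Proof.
rewrite /pairing /weight [RHS]big_mkcond; apply: eq_bigr => i _.
by rewrite ffunE; case: (i \in b); rewrite ?mulr1 ?mulr0.
Qed.

Lemma combination_ffunE k (w : 'I_k -> R) (p : 'I_k -> {ffun T -> R^o}) i :
  (\sum_j w j *: p j) i = \sum_j w j * p j i.
Proof. by rewrite sum_ffunE; apply: eq_bigr => j _; rewrite ffunE. Qed.

Lemma pairing_combination y k (w : 'I_k -> R) (p : 'I_k -> {ffun T -> R^o}) :
  pairing y (\sum_j w j *: p j) = \sum_j w j * pairing y (p j).
Proof.
rewrite /pairing; under eq_bigr do rewrite combination_ffunE mulr_sumr.
rewrite exchange_big; apply: eq_bigr => j _.
by rewrite mulr_sumr; apply: eq_bigr => i _; rewrite mulrCA.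
Qed.

Lemma indicator_polytope m b : b \in bases m ->
  matroid_polytope m (indicator R b).
Proof.
move=> bm; exists 1%N, (fun=> 1), (fun=> indicator R b); split=> //.
- by rewrite big_ord1.
- by move=> _; exists b.
- by rewrite big_ord1 scale1r.
Qed.

Lemma polytope_pairing_le m y x (c : R) :
    (forall b, b \in bases m -> weight y b <= c) ->
  matroid_polytope m x -> pairing y x <= c.
Proof.
move=> le_c [k [w [p [w0 w1 pm ->]]]]; rewrite pairing_combination.
rewrite -[c]mul1r -w1 mulr_suml; apply: ler_sum => j _.
have [b /= bm <-] := pm j.
by rewrite pairing_indicator ler_wpM2l ?w0 ?le_c.
Qed.

(** 0/1-vectors are extreme in the cube: the points of positive coefficient in a
    convex combination of 0/1-vectors equal to [indicator b] must all be
    [indicator b]. *)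
Lemma polytope_indicator m b : matroid_polytope m (indicator R b) ->
  b \in bases m.
Proof.
move=> [k [w [p [w0 w1 pm E]]]].
have [j wj] : exists j, w j != 0.
  apply/existsP; rewrite -[X in is_true X]negbK negb_exists; apply/negP => /forallP wz.
  have := w1; rewrite big1 => [/eqP|j _]; first by rewrite eq_sym oner_eq0.
  by have := wz j; rewrite negbK => /eqP.
have [c /= cm pj] := pm j.
have p01 i l : 0 <= p l i <= 1.
  by have [d _ <-] := pm l; rewrite ffunE; case: (i \in d); rewrite ?lexx ?ler01.
suff -> : b = c by [].
apply/setP=> i; have := congr1 (fun x : {ffun T -> R^o} => x i) E.
rewrite combination_ffunE ffunE; case: (i \in b) => /esym Ei.
  have sum0 : \sum_l w l * (1 - p l i) = 0.
    under eq_bigr do rewrite mulrBr mulr1.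
    by rewrite sumrB w1 Ei subrr.
  have ge0 l : 0 <= w l * (1 - p l i).
    by rewrite mulr_ge0 ?subr_ge0 //; case/andP: (p01 i l).
  have /eqP := psumr_eq0P (P := xpredT) (fun l _ => ge0 l) sum0 (i := j) isT.
  rewrite mulf_eq0 (negbTE wj) subr_eq0 -pj ffunE.
  by case: (i \in c); rewrite // oner_eq0.
have ge0 l : 0 <= w l * p l i by rewrite mulr_ge0 //; case/andP: (p01 i l).
have /eqP := psumr_eq0P (P := xpredT) (fun l _ => ge0 l) Ei (i := j) isT.
rewrite mulf_eq0 (negbTE wj) -pj ffunE.
by case: (i \in c); rewrite // oner_eq0.
Qed.

(** A linear functional on a polytope is maximal exactly on the convex hull of
    the vertices where it is maximal, and a basis is recovered from its vertex. *)
Lemma matroid_faceP n m :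
  matroid_face R n m <-> optimal_face R (bases m) (bases n).
Proof.
have [[b0 b0n] _ _] := bases_axiomP _ _ (basesP n).
split=> [[[->|[y F]] [z nz]]|[_ [y0 [nm le_n eq_n]]]]; first by [].
  have inF x : matroid_polytope n x <->
      matroid_polytope m x /\ forall z, matroid_polytope m z ->
        pairing y z <= pairing y x by rewrite F.
  split; first by apply/set0Pn; exists b0.
  exists y; split=> [b bn|b b' bm b'n|b b' bm b'n le_b].
  - by apply: polytope_indicator; case/inF: (indicator_polytope bn).
  - case/inF: (indicator_polytope b'n) => _ /(_ _ (indicator_polytope bm)).
    by rewrite !pairing_indicator.
  - apply/polytope_indicator/inF; split; first exact: indicator_polytope.
    case/inF: (indicator_polytope b'n) => _ max_b' x /max_b' /le_trans; apply.
    by rewrite !pairing_indicator.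
pose y : {ffun T -> R^o} := [ffun i => y0 i].
have wE b : weight y b = weight y0 b by apply: eq_bigr => i _; rewrite ffunE.
split; last by exists (indicator R b0); apply: indicator_polytope.
right; exists y; apply/predeqP => x.
have le_max z : matroid_polytope m z -> pairing y z <= weight y b0.
  by apply: polytope_pairing_le => b bm; rewrite !wE le_n.
split=> [[k [w [p [w0 w1 pn xE]]]]|[[k [w [p [w0 w1 pm xE]]]] xmax]].
  split.
    exists k, w, p; split=> // j; have [b /= bn <-] := pn j.
    by exists b => //; apply: nm.
  move=> z /le_max /le_trans; apply.
  rewrite xE pairing_combination -[leLHS]mul1r -w1 mulr_suml; apply: ler_sum => j _.
  by have [b /= bn <-] := pn j; rewrite pairing_indicator ler_wpM2l ?w0 // !wE le_n ?nm.
have w_max j : w j != 0 -> pairing y (p j) = weight y b0.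
  move=> wj; apply/eqP; rewrite eq_sym -subr_eq0.
  have p_le l : 0 <= weight y b0 - pairing y (p l).
    rewrite subr_ge0; have [b /= bm <-] := pm l.
    by apply/le_max/indicator_polytope.
  have sum0 : \sum_l w l * (weight y b0 - pairing y (p l)) = 0.
    under eq_bigr do rewrite mulrBr.
    apply/eqP; rewrite sumrB -mulr_suml w1 mul1r -pairing_combination -xE subr_eq0.
    rewrite eq_le -{1}(pairing_indicator y b0) xmax /=; last first.
      exact/indicator_polytope/nm.
    by apply: le_max; exists k, w, p.
  have ge0 l : 0 <= w l * (weight y b0 - pairing y (p l)) by rewrite mulr_ge0.
  have /eqP := psumr_eq0P (P := xpredT) (fun l _ => ge0 l) sum0 (i := j) isT.
  by rewrite mulf_eq0 (negbTE wj).
(* Points of coefficient 0 may lie off the face; they are moved to [b0]. *)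
exists k, w, (fun j => if w j == 0 then indicator R b0 else p j); split=> //.
  move=> j; case: eqVneq => [_|wj]; first by exists b0.
  have := w_max j wj; have [b /= bm <-] := pm j; rewrite pairing_indicator => E.
  by exists b => //=; apply: (eq_n _ b0 bm b0n); rewrite -!wE E.
rewrite xE; apply: eq_bigr => j _; case: eqVneq => // ->.
by rewrite !scale0r.
Qed.

End Faces.

(** * The antipode *)

Section Antipode.
Variables (K : fieldType).

Lemma linext_vect (X Y : finType) (f : X -> Y) x :
  linext f (vect K x) = vect K (f x).
Proof.
rewrite /linext (bigD1 x) //= ffunE eqxx scale1r big1 ?addr0 // => x' ne.
by rewrite ffunE (negbTE ne) scale0r.
Qed.

Lemma vect_inj (X : finType) : injective (@vect K X).
Proof.
move=> x x' /ffunP/(_ x); rewrite !ffunE eqxx.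
by case: eqP => // _ /eqP; rewrite oner_eq0.
Qed.

Lemma antipode_coefficient (T : finType) (I : {set T}) (m n : matroid I) :
  antipode (vect K m) n =
    \sum_(0 <= k < #|I|.+1) \sum_(s : k.-tuple {set T} |
      ordered_decomposition I s && (flag_bases (bases m) s == bases n)) (-1) ^+ k.
Proof.
rewrite /antipode; case: ifPn => [/eqP I0|I0].
  subst I; rewrite signed_count_flags_set0 ?basesP // ffunE -val_eqE /=.
  by rewrite !(bases_axiom_set0 (basesP _)).
rewrite [RHS]big_nat_recl // (sum_tuple0 (fun s => ordered_decomposition I s &&
  (flag_bases (bases m) s == bases n))) ordered_decomposition_nil (negbTE I0) /= add0r.
rewrite big_add1 /= sum_ffunE; apply: eq_bigr => k _.
rewrite sum_ffunE big_mkcondr /=.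
rewrite [RHS](big_sub (fun s : k.+1.-tuple {set T} => ordered_decomposition I s)).
apply: eq_bigr => s _; rewrite /product /coproduct !linext_vect !ffunE.
rewrite -val_eqE /= bases_product_coproduct eq_sym.
by case: eqP => _; rewrite /GRing.scale /= ?mulr1 ?mulr0.
Qed.

End Antipode.

Theorem theorem14p4 (R : realType) (K : fieldType) (charK0 : [pchar K] =i pred0)
    (T : finType) (I : {set T}) (m : matroid I) :
  [/\ antipode (vect K m) =
        \sum_(n : matroid I | `[< matroid_face R n m >])
          ((-1) ^+ num_components n : int)%:~R *: vect K n,
      cancellation_free (fun n : matroid I => matroid_face R n m)
        (fun n => (-1) ^+ num_components n) (fun n => vect K n) &
      grouping_free (fun n : matroid I => matroid_face R n m)
        (fun n => vect K n)].
Proof.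
split; last 2 first.
- by move=> a b _ _ ab /vect_inj.
- by move=> a b _ _ ab /vect_inj.
apply/ffunP=> n; rewrite antipode_coefficient.
rewrite (signed_count_flags R K (bases n) (leqnn _) (basesP m)).
rewrite sum_ffunE -num_componentsE -(asbool_equiv_eq (matroid_faceP R n m)).
rewrite big_mkcond (bigD1 n) //= big1 ?addr0 => [|n' ne]; last first.
  by case: ifP => // _; rewrite !ffunE eq_sym (negbTE ne) scaler0.
by case: ifP => // _; rewrite !ffunE eqxx rmorphXn rmorphN1 /GRing.scale /= mulr1.
Qed.
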